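(* Let $G$ be a group. The set $T_{\chi}(G)=\{[g,h^{\varphi}]\mid g,h\in G\}\subseteq\chi(G)$ is finite if and only if the subgroup $D(G)=[G,G^{\varphi}]=\langle [g,h^{\varphi}]\mid g,h\in G\rangle\leqslant\chi(G)$ is finite.
   Context: For a group $G$, let $G^{\varphi}$ be a (disjoint) copy of $G$, isomorphic to $G$ via $\varphi: G\to G^{\varphi}$, $g\mapsto g^{\varphi}$. The weak commutativity group of $G$ is $$\chi(G)=\langle G\cup G^{\varphi}\mid [g,g^{\varphi}]=1,\ \forall g\in G\rangle,$$ i.e. the quotient of the free product $G * G^{\varphi}$ by the normal closure of all commutators $[g,g^{\varphi}]$, $g\in G$, where $[x,y]=x^{-1}y^{-1}xy$. Elements $g\in G$ and $h^{\varphi}\in G^{\varphi}$ are identified with their images in $\chi(G)$, and commutators $[g,h^{\varphi}]$ are computed in $\chi(G)$. *)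

(* Defs.v *)
From HB Require Import structures.
From mathcomp Require Import all_boot.
From mathcomp Require Import boolp classical_sets cardinality.

(* Groups are [groupType]s: possibly infinite, with
   [[~ x, y] = x^-1 * (y^-1 * (x * y))].  The [choiceType] structure that
   [groupType] carries is available on every type by the axioms of [boolp]. *)

Set Implicit Arguments.
Unset Strict Implicit.
Unset Printing Implicit Defensive.

Local Open Scope classical_set_scope.
Local Open Scope group_scope.
Local Open Scope quotient_scope.

Definition is_subgroup (H : groupType) (A : set H) : Prop :=
  group_closed [in A].

Definition is_normal_subgroup (H : groupType) (A : set H) : Prop :=
  is_subgroup A /\ forall x y : H, A x -> A (x ^ y).

Definition generated (H : groupType) (S : set H) : set H :=
  smallest (@is_subgroup H) S.

Definition normal_closure (H : groupType) (S : set H) : set H :=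
  smallest (@is_normal_subgroup H) S.

(* The quotient of H by the normal closure of S, that is, H with the relations
   [s = 1], s in S, imposed. *)

Definition ncl_rel (H : groupType) (S : set H) : rel H :=
  fun x y => `[< normal_closure S (x^-1 * y) >].

Lemma normal_closureP (H : groupType) (S : set H) :
  [/\ normal_closure S 1,
      forall x y, normal_closure S x -> normal_closure S y ->
        normal_closure S (x * y),
      forall x, normal_closure S x -> normal_closure S x^-1
    & forall x y, normal_closure S x -> normal_closure S (x ^ y)].
Proof.
have gcl A : is_subgroup A -> [/\ A 1, forall x y : H, A x -> A y -> A (x * y)
    & forall x : H, A x -> A x^-1].
  move=> gA; split=> [|x y Ax Ay|x Ax].
  - by case: gA; rewrite inE.
  - suff: x * y \in A by rewrite inE.
    by apply: (group_closedM gA); rewrite inE.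
  - suff: x^-1 \in A by rewrite inE.
    by apply: (group_closedV gA); rewrite inE.
split=> [A|x y Sx Sy A HA|x Sx A HA|x y Sx A HA].
- by case=> -[/gcl[A1 _ _] _] _.
- by have [[/gcl[_ gM _] _] _] := HA; apply: gM; [apply: Sx|apply: Sy].
- by have [[/gcl[_ _ gV] _] _] := HA; apply: gV; apply: Sx.
- by have [[_ nA] _] := HA; apply: nA; apply: Sx.
Qed.

Lemma ncl_rel_refl (H : groupType) (S : set H) : reflexive (ncl_rel S).
Proof.
by move=> x; apply/asboolP; rewrite mulVg; case: (normal_closureP S).
Qed.

Lemma ncl_rel_sym (H : groupType) (S : set H) : symmetric (ncl_rel S).
Proof.
have [_ _ nV _] := normal_closureP S.
by move=> x y; apply/asboolP/asboolP => /nV; rewrite invgM invgK.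
Qed.

Lemma ncl_rel_trans (H : groupType) (S : set H) : transitive (ncl_rel S).
Proof.
have [_ nM _ _] := normal_closureP S.
move=> y x z /asboolP xy /asboolP yz; apply/asboolP.
by have := nM _ _ xy yz; rewrite mulgA mulgK.
Qed.

Canonical ncl_equiv (H : groupType) (S : set H) : equiv_rel H :=
  EquivRel (ncl_rel S) (@ncl_rel_refl H S) (@ncl_rel_sym H S)
    (@ncl_rel_trans H S).

Definition quot_ncl (H : groupType) (S : set H) : Type :=
  {eq_quot (ncl_equiv S)}.

HB.instance Definition _ (H : groupType) (S : set H) :=
  Choice.on (quot_ncl S).
HB.instance Definition _ (H : groupType) (S : set H) :=
  EqQuotient.on (quot_ncl S).

Definition quot_pi (H : groupType) (S : set H) (x : H) : quot_ncl S :=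
  \pi_(quot_ncl S) x.

Definition quot_one (H : groupType) (S : set H) : quot_ncl S := quot_pi S 1.
Definition quot_mul (H : groupType) (S : set H) :
  quot_ncl S -> quot_ncl S -> quot_ncl S := lift_op2 (quot_ncl S) *%g.
Definition quot_inv (H : groupType) (S : set H) : quot_ncl S -> quot_ncl S :=
  lift_op1 (quot_ncl S) (@inv H).

Lemma quot_piP (H : groupType) (S : set H) (x y : H) :
  quot_pi S x = quot_pi S y <-> normal_closure S (x^-1 * y).
Proof.
split=> [/eqmodP /asboolP //|xy].
by apply/eqmodP/asboolP.
Qed.

Lemma quot_reprK (H : groupType) (S : set H) (a : quot_ncl S) :
  quot_pi S (repr a) = a.
Proof. exact: reprK. Qed.

Lemma quot_piM (H : groupType) (S : set H) (x y : H) :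
  quot_mul (quot_pi S x) (quot_pi S y) = quot_pi S (x * y).
Proof.
have [_ nM _ nJ] := normal_closureP S.
rewrite /quot_mul; unlock.
set x' := repr (quot_pi S x); set y' := repr (quot_pi S y).
have xx' : normal_closure S (x'^-1 * x) by apply/quot_piP; exact: quot_reprK.
have yy' : normal_closure S (y'^-1 * y) by apply/quot_piP; exact: quot_reprK.
apply/quot_piP.
have -> : (x' * y')^-1 * (x * y) = (x'^-1 * x) ^ y' * (y'^-1 * y).
  by rewrite /conjg invgM !mulgA mulgK.
by apply: nM => //; exact: nJ.
Qed.

Lemma quot_piV (H : groupType) (S : set H) (x : H) :
  quot_inv (quot_pi S x) = quot_pi S x^-1.
Proof.
have [_ _ nV nJ] := normal_closureP S.
rewrite /quot_inv; unlock.
set x' := repr (quot_pi S x).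
have xx' : normal_closure S (x^-1 * x').
  by apply/quot_piP; apply/esym; exact: quot_reprK.
apply/quot_piP.
have -> : x'^-1^-1 * x^-1 = (x^-1 * x') ^ x^-1.
  by rewrite /conjg !invgK !mulgA mulgV mul1g.
exact: nJ.
Qed.

Lemma quot_mulA (H : groupType) (S : set H) : associative (@quot_mul H S).
Proof.
move=> a b c.
by rewrite -(quot_reprK a) -(quot_reprK b) -(quot_reprK c) !quot_piM mulgA.
Qed.

Lemma quot_1mul (H : groupType) (S : set H) :
  left_id (quot_one S) (@quot_mul H S).
Proof. by move=> a; rewrite -(quot_reprK a) quot_piM mul1g. Qed.

Lemma quot_mul1 (H : groupType) (S : set H) :
  right_id (quot_one S) (@quot_mul H S).
Proof. by move=> a; rewrite -(quot_reprK a) quot_piM mulg1. Qed.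

Lemma quot_Vmul (H : groupType) (S : set H) :
  left_inverse (quot_one S) (@quot_inv H S) (@quot_mul H S).
Proof. by move=> a; rewrite -(quot_reprK a) quot_piV quot_piM mulVg. Qed.

Lemma quot_mulV (H : groupType) (S : set H) :
  right_inverse (quot_one S) (@quot_inv H S) (@quot_mul H S).
Proof. by move=> a; rewrite -(quot_reprK a) quot_piV quot_piM mulgV. Qed.

HB.instance Definition _ (H : groupType) (S : set H) :=
  isGroup.Build (quot_ncl S) (@quot_mulA H S) (@quot_1mul H S)
    (@quot_mul1 H S) (@quot_Vmul H S) (@quot_mulV H S).

(* The free product of H and K: words in the disjoint union of H and K, modulo
   the congruence that multiplies adjacent letters of the same factor and
   erases the two identities. *)

Inductive word_eq (H K : groupType) : seq (H + K) -> seq (H + K) -> Prop :=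
| word_refl u : word_eq u u
| word_sym u v : word_eq u v -> word_eq v u
| word_trans u v w : word_eq u v -> word_eq v w -> word_eq u w
| word_cat u u' v v' : word_eq u u' -> word_eq v v' ->
    word_eq (u ++ v) (u' ++ v')
| word_one_l : word_eq [:: inl 1] [::]
| word_one_r : word_eq [:: inr 1] [::]
| word_mul_l (x y : H) : word_eq [:: inl x; inl y] [:: inl (x * y)]
| word_mul_r (x y : K) : word_eq [:: inr x; inr y] [:: inr (x * y)].

Definition word_rel (H K : groupType) : rel (seq (H + K)) :=
  fun u v => `[< word_eq u v >].

Lemma word_rel_refl (H K : groupType) : reflexive (@word_rel H K).
Proof. by move=> u; apply/asboolP; constructor. Qed.

Lemma word_rel_sym (H K : groupType) : symmetric (@word_rel H K).
Proof. by move=> u v; apply/asboolP/asboolP; apply: word_sym. Qed.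

Lemma word_rel_trans (H K : groupType) : transitive (@word_rel H K).
Proof.
move=> v u w /asboolP uv /asboolP vw; apply/asboolP.
exact: word_trans uv vw.
Qed.

Canonical word_equiv (H K : groupType) : equiv_rel (seq (H + K)) :=
  EquivRel (@word_rel H K) (@word_rel_refl H K) (@word_rel_sym H K)
    (@word_rel_trans H K).

Definition freeprod (H K : groupType) : Type := {eq_quot (word_equiv H K)}.

HB.instance Definition _ (H K : groupType) := Choice.on (freeprod H K).
HB.instance Definition _ (H K : groupType) := EqQuotient.on (freeprod H K).

Definition free_pi (H K : groupType) (u : seq (H + K)) : freeprod H K :=
  \pi_(freeprod H K) u.

Definition letter_inv (H K : groupType) (a : H + K) : H + K :=
  match a with inl x => inl x^-1 | inr x => inr x^-1 end.

Definition word_inv (H K : groupType) (u : seq (H + K)) : seq (H + K) :=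
  rev (map (@letter_inv H K) u).

Definition free_one (H K : groupType) : freeprod H K := free_pi [::].
Definition free_mul (H K : groupType) :
  freeprod H K -> freeprod H K -> freeprod H K := lift_op2 (freeprod H K) cat.
Definition free_inv (H K : groupType) : freeprod H K -> freeprod H K :=
  lift_op1 (freeprod H K) (@word_inv H K).

Lemma free_piP (H K : groupType) (u v : seq (H + K)) :
  free_pi u = free_pi v <-> word_eq u v.
Proof. by split=> [/eqmodP /asboolP //|uv]; apply/eqmodP/asboolP. Qed.

Lemma free_reprK (H K : groupType) (a : freeprod H K) : free_pi (repr a) = a.
Proof. exact: reprK. Qed.

Lemma free_piM (H K : groupType) (u v : seq (H + K)) :
  free_mul (free_pi u) (free_pi v) = free_pi (u ++ v).
Proof.
by rewrite /free_mul; unlock; apply/free_piP/word_cat; apply/free_piP; exact: free_reprK.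
Qed.

Lemma word_inv_cat (H K : groupType) (u v : seq (H + K)) :
  word_inv (u ++ v) = word_inv v ++ word_inv u.
Proof. by rewrite /word_inv map_cat rev_cat. Qed.

Lemma word_eq_inv (H K : groupType) (u v : seq (H + K)) :
  word_eq u v -> word_eq (word_inv u) (word_inv v).
Proof.
elim=> {u v} [u|u v _|u v w _ uv _ vw|u u' v v' _ uu' _ vv'| | |x y|x y].
- exact: word_refl.
- exact: word_sym.
- exact: word_trans uv vw.
- by rewrite !word_inv_cat; apply: word_cat.
- by rewrite /word_inv /= invg1; apply: word_one_l.
- by rewrite /word_inv /= invg1; apply: word_one_r.
- by rewrite /word_inv /= invgM; apply: word_mul_l.
- by rewrite /word_inv /= invgM; apply: word_mul_r.
Qed.

Lemma word_invK (H K : groupType) : involutive (@word_inv H K).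
Proof.
move=> u; rewrite /word_inv map_rev revK -map_comp.
by rewrite map_id_in // => -[x|x] _ /=; rewrite invgK.
Qed.

Lemma word_mulV (H K : groupType) (u : seq (H + K)) :
  word_eq (u ++ word_inv u) [::].
Proof.
elim: u => [|a u IHu]; first exact: word_refl.
rewrite -cat1s word_inv_cat -catA (catA u).
have sub : word_eq ([:: a] ++ (u ++ word_inv u) ++ word_inv [:: a])
                   ([:: a] ++ [::] ++ word_inv [:: a]).
  by apply: word_cat; [exact: word_refl|apply: word_cat => //; exact: word_refl].
apply: word_trans sub _.
case: a => x; rewrite /word_inv /=.
- by apply: word_trans (word_mul_l _ _ _) _; rewrite mulgV; apply: word_one_l.
- by apply: word_trans (word_mul_r _ _ _) _; rewrite mulgV; apply: word_one_r.
Qed.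

Lemma free_piV (H K : groupType) (u : seq (H + K)) :
  free_inv (free_pi u) = free_pi (word_inv u).
Proof.
by rewrite /free_inv; unlock; apply/free_piP/word_eq_inv; apply/free_piP; exact: free_reprK.
Qed.

Lemma free_mulA (H K : groupType) : associative (@free_mul H K).
Proof.
move=> a b c.
by rewrite -(free_reprK a) -(free_reprK b) -(free_reprK c) !free_piM catA.
Qed.

Lemma free_1mul (H K : groupType) : left_id (free_one H K) (@free_mul H K).
Proof. by move=> a; rewrite -(free_reprK a) free_piM. Qed.

Lemma free_mul1 (H K : groupType) : right_id (free_one H K) (@free_mul H K).
Proof. by move=> a; rewrite -(free_reprK a) free_piM cats0. Qed.

Lemma free_mulV (H K : groupType) :
  right_inverse (free_one H K) (@free_inv H K) (@free_mul H K).
Proof.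
move=> a; rewrite -(free_reprK a) free_piV free_piM.
by apply/free_piP; exact: word_mulV.
Qed.

Lemma free_Vmul (H K : groupType) :
  left_inverse (free_one H K) (@free_inv H K) (@free_mul H K).
Proof.
move=> a; rewrite -(free_reprK a) free_piV free_piM; apply/free_piP.
by rewrite -{2}(word_invK (repr a)); exact: word_mulV.
Qed.

HB.instance Definition _ (H K : groupType) :=
  isGroup.Build (freeprod H K) (@free_mulA H K) (@free_1mul H K)
    (@free_mul1 H K) (@free_Vmul H K) (@free_mulV H K).

Definition free_inl (H K : groupType) (x : H) : freeprod H K :=
  free_pi [:: inl x].
Definition free_inr (H K : groupType) (x : K) : freeprod H K :=
  free_pi [:: inr x].

(* The disjoint copy of G is the second factor of [freeprod G G], so that
   [free_inr G g] is the image of g under the isomorphism onto the copy. *)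

Definition chi_relators (G : groupType) : set (freeprod G G) :=
  [set x | exists g : G, x = [~ free_inl G g, free_inr G g]].

Arguments chi_relators G : clear implicits.

Definition chi (G : groupType) : groupType := quot_ncl (chi_relators G).

Definition chi_inl (G : groupType) (g : G) : chi G :=
  quot_pi (chi_relators G) (free_inl G g).
Definition chi_inr (G : groupType) (g : G) : chi G :=
  quot_pi (chi_relators G) (free_inr G g).

Definition T_chi (G : groupType) : set (chi G) :=
  [set x | exists g h : G, x = [~ chi_inl g, chi_inr h]].

Arguments T_chi G : clear implicits.

Definition D_chi (G : groupType) : set (chi G) := generated (T_chi G).

Arguments D_chi G : clear implicits.

(* Main.v *)
Require Import Defs.
From mathcomp Require Import all_boot.
From mathcomp Require Import boolp classical_sets cardinality.

(** Only the passage from T = T_chi(G) to D = D_chi(G) has content, since T is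
    a subset of D.  Write c(g, h) for [g, h^phi].

    The relations applied to a product gh give c(g, h) = [g^phi, h], and then
    that k and k^phi act on D by the same conjugation ([cross_swap],
    [cross_conj_ab]).  So conjugation on D is through elements of G, and as
    c(gk, h) = c(g, h)^k c(k, h), the conjugates of T lie in T T^-1: the
    normal set X of all conjugates of T is finite ([T_chi_conj_finite]), and it
    generates D.

    A finite normal set generates a finite group as soon as each of its
    elements has a power that is a shorter word in the set
    ([generated_finite_of_short_powers]).  For torsion elements this is
    Dietzmann's lemma, so it is enough that each c(g, h) has finite order.  The
    same criterion, applied to the commutators [x, y] with x in X and y in D,
    gives a form of Schur's theorem: they generate a finite normal subgroup N
    ([generated_mixed_commutators_finite]).  It is therefore enough that c(g, h)
    has finite order modulo N, where D becomes abelian.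

    Suppose then that D is abelian ([cross_finite_order]).  The commutator
    [k, l] acts on D as [k, l^phi], an element of D, hence trivially.  Put
    e = [h, g] and t = c(g, h).  From h^g = he comes t^g = c(g, e) t, and
    c(g, e^n) = c(g, e)^n because e acts trivially; T being finite, c(g, e) has
    finite order n.  Hence t^n is fixed by g, so c(g^m, h)^n = t^(nm) for all m,
    and finiteness of T shows that t^n, hence t, has finite order. *)

Set Implicit Arguments.
Unset Strict Implicit.
Unset Printing Implicit Defensive.

Local Open Scope classical_set_scope.
Local Open Scope group_scope.

Definition finite_order (H : groupType) (x : H) : Prop :=
  exists2 n, 0 < n & x ^+ n = 1.

(** * Generated subgroups *)

Section Generated.
Variables (H : groupType) (S : set H).

Lemma is_subgroupP (A : set H) :
  A 1 -> (forall x y, A x -> A y -> A (x * y)) -> (forall x, A x -> A x^-1) ->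
  is_subgroup A.
Proof.
move=> A1 AM AV; split; first by rewrite inE.
by move=> x y; rewrite !inE => Ax Ay; apply/AM/AV.
Qed.

Lemma sub_generated : S `<=` generated S.
Proof. by move=> x Sx A [_]; apply. Qed.

Lemma generated_ind (A : set H) :
  A 1 -> (forall x y, A x -> A y -> A (x * y)) -> (forall x, A x -> A x^-1) ->
  S `<=` A -> generated S `<=` A.
Proof.
by move=> A1 AM AV SA; apply: smallest_sub => //; exact: is_subgroupP.
Qed.

Lemma generated1 : generated S 1.
Proof. by move=> A [[+ _] _]; rewrite inE. Qed.

Lemma generatedM x y : generated S x -> generated S y -> generated S (x * y).
Proof.
move=> Sx Sy A [gA SA]; have := group_closedM gA (x := x) (y := y).
by rewrite !inE; apply; [apply: Sx|apply: Sy].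
Qed.

Lemma generatedV x : generated S x -> generated S x^-1.
Proof.
move=> Sx A [gA SA]; have := group_closedV gA (x := x).
by rewrite !inE; apply; apply: Sx.
Qed.

Lemma generated_conj w :
  (forall x, S x -> S (x ^ w)) ->
  forall x, generated S x -> generated S (x ^ w).
Proof.
move=> Sw; apply: generated_ind.
- by rewrite conj1g; exact: generated1.
- by move=> x y; rewrite conjMg; exact: generatedM.
- by move=> x; rewrite conjVg; exact: generatedV.
- by move=> x /Sw; exact: sub_generated.
Qed.

(** A normal set generates a normal subgroup, which is then its normal
    closure. *)
Lemma normal_closure_sub_generated :
  (forall x w, S x -> S (x ^ w)) -> normal_closure S `<=` generated S.
Proof.
move=> Sconj; apply: smallest_sub; last exact: sub_generated.
split.
- apply: is_subgroupP; [exact: generated1|exact: generatedM|exact: generatedV].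
- by move=> x w; apply: generated_conj => y; exact: Sconj.
Qed.

End Generated.

(** * Finite order by pigeonhole *)

Lemma finite_set_pigeonhole (T : choiceType) (A : set T) (f : nat -> T) :
  finite_set A -> (forall n, A (f n)) ->
  exists i j, i < j /\ f i = f j.
Proof.
move=> /finite_seqP[s ->] Af.
have : ~~ uniq (map f (iota 0 (size s).+1)).
  apply/negP => /(@uniq_leq_size _ _ s); rewrite size_map size_iota ltnn.
  by move=> lt; apply/notF/lt => _ /mapP[n _ ->]; exact: Af.
move=> /(uniqPn (f 0))[i [j [ij]]]; rewrite size_map size_iota => js.
rewrite !(nth_map 0) ?size_iota ?(ltn_trans ij) // !nth_iota ?(ltn_trans ij) //.
by exists i, j.
Qed.

Lemma finite_order_powers (H : groupType) (A : set H) (x : H) :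
  finite_set A -> (forall n, A (x ^+ n)) -> finite_order x.
Proof.
move=> finA /(finite_set_pigeonhole finA)[i [j [ij e]]].
exists (j - i); first by rewrite subn_gt0.
by rewrite expgnFr ?(ltnW ij) // -e mulgV.
Qed.

Lemma finite_orderX (H : groupType) (x : H) n :
  0 < n -> finite_order (x ^+ n) -> finite_order x.
Proof.
by move=> n0 [m m0 e]; exists (n * m)%N; rewrite ?muln_gt0 ?n0 // expgnA.
Qed.

Lemma finite_orderJ (H : groupType) (x y : H) :
  finite_order x -> finite_order (x ^ y).
Proof. by case=> n n0 e; exists n; rewrite // -conjXg e conj1g. Qed.

(** By conjugation z permutes the finite set X, so some power of z acts
    trivially. *)
Lemma finite_conj_powers_commute (H : groupType) (X : set H) (z : H) :
  finite_set X -> (forall x, X x -> X (x ^ z)) ->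
  exists2 n, 0 < n & forall x, X x -> commute x (z ^+ n).
Proof.
move=> finX Xz.
have each x : X x -> exists2 n, 0 < n & commute x (z ^+ n).
  move=> Xx; have Xn n : X (x ^ (z ^+ n)).
    by elim: n => [|n IH]; rewrite ?conjg1 // expgSr conjgM; exact: Xz.
  have [i [j [ij e]]] := finite_set_pigeonhole finX Xn.
  exists (j - i); first by rewrite subn_gt0.
  apply/commgP; rewrite -conjg_fix; apply/eqP/(@conjg_inj _ (z ^+ i)).
  by rewrite -conjgM -expgnDr subnK // ltnW.
have [s sX] := (finite_seqP _).1 finX.
suff: exists2 n, 0 < n & forall x, x \in s -> commute x (z ^+ n).
  by case=> n n0 cs; exists n => // x; rewrite sX => /cs.
have {each} : forall x, x \in s -> exists2 n, 0 < n & commute x (z ^+ n).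
  by move=> x xs; apply: each; rewrite sX.
elim: (s) => [|x r IH] each; first by exists 1%N.
have [|n n0 cr] := IH; first by move=> y yr; apply: each; rewrite inE yr orbT.
have [m m0 cx] := each x (mem_head _ _).
exists (n * m)%N; first by rewrite muln_gt0 n0.
move=> y; rewrite inE => /predU1P[->|/cr cy].
  by rewrite mulnC expgnA; exact: commuteX.
by rewrite expgnA; exact: commuteX.
Qed.

(** * Dietzmann's lemma *)

Lemma leq_size_count (T : eqType) (s w : seq T) B :
  {subset w <= s} -> (forall x, x \in s -> count_mem x w <= B) ->
  size w <= (size s * B)%N.
Proof.
elim: s w => [|x s IH] w ws wB.
  by case: w ws {wB} => // y w /(_ y (mem_head _ _)).
rewrite mulSn -(count_predC (pred1 x)) leq_add ?wB ?mem_head //.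
rewrite -size_filter; apply: IH => [y|y ys].
  rewrite mem_filter /= => /andP[yx /ws]; rewrite inE => /predU1P[e|//].
  by rewrite e eqxx in yx.
apply: leq_trans (wB y _); last by rewrite inE ys orbT.
by rewrite count_filter; apply: sub_count => z /andP[].
Qed.

Section Dietzmann.
Variables (H : groupType) (X : set H).

Hypothesis XJ : forall x y, X x -> X y -> X (x ^ y).

(** Moving an occurrence of x to the front conjugates the letters before it by
    x; this keeps them in X and keeps the number of occurrences of x, so that m
    occurrences can be moved in turn. *)
Lemma gather_power x w m : X x -> (forall y, y \in w -> X y) ->
  m <= count_mem x w ->
  exists w', [/\ size w = (m + size w')%N, forall y, y \in w' -> X y
    & \prod_(y <- w) y = x ^+ m * \prod_(y <- w') y].
Proof.
move=> Xx; elim: m w => [|m IH] w Xw mw.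
  by exists w; rewrite mul1g; split.
have xw : x \in w by rewrite -has_pred1 has_count (leq_trans _ mw).
case/splitPr: xw Xw mw => u v Xw mw.
have cu : count_mem x [seq y ^ x | y <- u] = count_mem x u.
  have xx : x ^ x = x by rewrite conjgE mulKg.
  rewrite count_map; apply: eq_count => y /=.
  by rewrite -{2}xx (inj_eq (@conjg_inj _ x)).
have [y||w' [sz Xw' e]] := IH ([seq y ^ x | y <- u] ++ v).
- rewrite mem_cat => /orP[/mapP[y' y'u ->]|yv].
    by apply: XJ => //; apply: Xw; rewrite mem_cat y'u.
  by apply: Xw; rewrite mem_cat inE yv !orbT.
- by move: mw; rewrite !count_cat cu /= eqxx add1n addnS ltnS.
exists w'; split=> //.
  by move: sz; rewrite !size_cat size_map /= addnS addSn => ->.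
rewrite expgS -mulgA -e !big_cat big_cons /= big_map !mulgA; congr (_ * _).
by rewrite -conjg_prod conjgE !mulgA mulgV mul1g.
Qed.

Lemma finite_bounded_words n : finite_set X ->
  finite_set [set \prod_(y <- w) y | w in
    [set w : seq H | size w <= n /\ forall y, y \in w -> X y]].
Proof.
move=> finX; elim: n => [|n IH].
  apply: sub_finite_set (finite_set1 (1 : H)) => _ [[|y w] [//= _ _] <-].
  by rewrite big_nil.
have fin2 := finite_image2 (fun x y : H => x * y) finX IH.
have := conj IH fin2; rewrite -finite_setU; apply: sub_finite_set.
move=> _ [[|x w] [/= sz Xw] <-]; first by left; exists [::].
right; exists x; first by apply: Xw; rewrite mem_head.
rewrite big_cons; eexists; last by [].
by exists w => //; split=> // y yw; apply: Xw; rewrite inE yw orbT.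
Qed.

(** A word much longer than the size of X repeats some letter x often enough to
    gather x ^+ m in front and to replace it by a shorter word.  So words of
    bounded length already give all products.  These form a finite submonoid,
    which is closed under inverses because its elements have finite order. *)
Lemma generated_finite_of_short_powers : finite_set X ->
  (forall x, X x -> exists m (s : seq H),
     [/\ size s < m, forall y, y \in s -> X y & x ^+ m = \prod_(y <- s) y]) ->
  finite_set (generated X).
Proof.
move=> finX short; have [xs Xxs] := (finite_seqP _).1 finX.
(* One bound B serves for the exponents of all elements of X. *)
have [B shortB] : exists B, forall x, X x -> exists m (s : seq H),
    [/\ m <= B, size s < m, forall y, y \in s -> X y
      & x ^+ m = \prod_(y <- s) y].
  suff [B hB] : exists B, forall x, x \in xs -> exists m (s : seq H),
    [/\ m <= B, size s < m, forall y, y \in s -> X y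
      & x ^+ m = \prod_(y <- s) y].
    by exists B => x; rewrite {1}Xxs; exact: hB.
  have {short} : forall x, x \in xs -> exists m (s : seq H),
     [/\ size s < m, forall y, y \in s -> X y & x ^+ m = \prod_(y <- s) y].
    by move=> x xx; apply: short; rewrite Xxs.
  elim: (xs) => [|x r IH] short; first by exists 0.
  have [|B hB] := IH; first by move=> y yr; apply: short; rewrite inE yr orbT.
  have [m [s [sm Xs e]]] := short x (mem_head _ _).
  exists (maxn m B) => y; rewrite inE => /predU1P[->|/hB].
    by exists m, s; rewrite leq_maxl.
  case=> m' [s' [? ? ? ?]]; exists m', s'; rewrite leq_max; split=> //.
  by apply/orP; right.
pose P := [set \prod_(y <- w) y | w in
    [set w : seq H | size w <= (size xs * B)%N /\ forall y, y \in w -> X y]].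
have finP : finite_set P by exact: finite_bounded_words.
have wordP w : (forall y, y \in w -> X y) -> P (\prod_(y <- w) y).
  have [n] := ubnP (size w); elim: n w => // n IH w; rewrite ltnS => wn Xw.
  have [le|gt] := leqP (size w) (size xs * B)%N; first by exists w.
  have [[x [xx cx]]|no] := pselect (exists x, x \in xs /\ B < count_mem x w).
    have Xx : X x by rewrite Xxs.
    have [m [s [mB sm Xs e]]] := shortB x Xx.
    have [|w' [sz Xw' ->]] := @gather_power x w m Xx Xw.
      exact: leq_trans mB (ltnW cx).
    rewrite e -big_cat; apply: IH => [|y]; last first.
      by rewrite mem_cat => /orP[/Xs|/Xw'].
    by apply: leq_trans wn; rewrite size_cat sz ltn_add2r.
  suff : size w <= (size xs * B)%N by rewrite leqNgt gt.
  apply: leq_size_count => [y /Xw|y yx]; first by rewrite Xxs.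
  by rewrite leqNgt; apply/negP => cy; apply: no; exists y.
have P1 : P 1 by have := wordP [::]; rewrite big_nil; apply.
have PM x y : P x -> P y -> P (x * y).
  move=> [u [_ Xu] <-] [v [_ Xv] <-]; rewrite -big_cat; apply: wordP => z.
  by rewrite mem_cat => /orP[/Xu|/Xv].
have PX x n : P x -> P (x ^+ n).
  by move=> Px; elim: n => [//|n IH]; rewrite expgS; exact: PM.
apply: sub_finite_set (finP); apply: generated_ind => // [x Px|x Xx].
  have [[//|n] _ e] := finite_order_powers finP (fun n => PX x n Px).
  suff -> : x^-1 = x ^+ n by exact: PX.
  by apply: (mulgI x); rewrite mulgV -expgS.
by have := wordP [:: x]; rewrite big_seq1; apply => y; rewrite inE => /eqP->.
Qed.

Lemma generated_finite_of_finite_order : finite_set X ->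
  (forall x, X x -> finite_order x) -> finite_set (generated X).
Proof.
move=> finX tX; apply: generated_finite_of_short_powers => // x /tX[n n0 e].
by exists n, [::]; rewrite big_nil; split.
Qed.

End Dietzmann.

(** * A form of Schur's theorem *)

Section Schur.
Variables (H : groupType) (X : set H).
Hypothesis XJ : forall x w, X x -> X (x ^ w).

(** For X normal these generate the derived subgroup of the group D generated by
    X.  Taking x in X, and not in D, makes finiteness immediate: the elements
    are of the form x^-1 x' with x and x' in X. *)
Definition mixed_commutators : set H :=
  [set z | exists x y, [/\ X x, generated X y & z = [~ x, y]]].

Lemma mixed_commutatorsJ x w :
  mixed_commutators x -> mixed_commutators (x ^ w).
Proof.
move=> [u [v [Xu Dv ->]]]; exists (u ^ w), (v ^ w).
split; [exact: XJ| |by rewrite conjRg].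
by apply: generated_conj => // y; exact: XJ.
Qed.

(** Let z = [x, y].  Some power z^n with n > 0 centralises X, hence D, hence is
    fixed by y, so z^(n+1) = z (z^n)^y = z z^y (z^y)^(n-1), where
    z z^y = [x, y^2]: this is a word of length n in commutators of the same kind. *)
Lemma generated_mixed_commutators_finite : finite_set X ->
  finite_set (generated mixed_commutators).
Proof.
move=> finX; apply: generated_finite_of_short_powers.
- by move=> x y + _; exact: mixed_commutatorsJ.
- apply: sub_finite_set (finite_image2 (fun x y => x^-1 * y) finX finX).
  move=> _ [x [y [Xx _ ->]]]; exists x => //.
  by exists (x ^ y); [exact: XJ|rewrite commgEl].
move=> _ [x [y [Xx Dy ->]]]; set z := [~ x, y].
have [[//|n] _ zX] := finite_conj_powers_commute finX (fun u => @XJ u z).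
have zy : (z ^+ n.+1) ^ y = z ^+ n.+1.
  apply/conjg_fixP/commgP.
  suff: generated X `<=` [set u | commute (z ^+ n.+1) u] by apply.
  apply: generated_ind => [|u v|u|u Xu] /=.
  - exact: commute1.
  - exact: commuteM.
  - exact: commuteV.
  - exact/commute_sym/zX.
exists n.+2, ([~ x, y * y] :: nseq n ([~ x, y] ^ y)).
split; first by rewrite /= size_nseq.
  have Zz : mixed_commutators z by exists x, y.
  move=> u; rewrite inE => /predU1P[->|/nseqP[-> _]].
    by exists x, (y * y); split=> //; exact: generatedM.
  exact: mixed_commutatorsJ.
rewrite big_cons big_nseq -/(z ^ y) expgS -zy conjXg expgS.
have -> : [~ x, y * y] = z * z ^ y.
  by rewrite /z !commgEl conjgM [(_ * x ^ y) ^ y]conjMg conjVg -mulgA mulVKg.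
by rewrite -Monoid.iteropE mulgA.
Qed.

End Schur.

(** * Two homomorphisms with pointwise commuting values *)

Lemma morph_inv (G K : groupType) (f : G -> K) :
  {morph f : x y / x * y} -> {morph f : x / x^-1}.
Proof.
move=> fM x; apply: (mulgI (f x)); rewrite -fM !mulgV.
by apply: (mulgI (f 1)); rewrite -fM !mulg1.
Qed.

Lemma morph_commute (G K : groupType) (f : G -> K) :
  {morph f : x y / x * y} -> forall x y, commute x y -> commute (f x) (f y).
Proof. by move=> fM x y xy; rewrite /commute -!fM xy. Qed.

(** The identities are needed both in chi(G) and in its quotient where D becomes
    abelian, whence an arbitrary target group. *)
Section WeaklyCommuting.
Variables (G Q : groupType) (a b : G -> Q).
Hypothesis aM : {morph a : x y / x * y}.
Hypothesis bM : {morph b : x y / x * y}.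
Hypothesis abC : forall g, commute (a g) (b g).

Definition cross_commutators : set Q :=
  [set x | exists g h : G, x = [~ a g, b h]].

Local Notation T := cross_commutators.
Local Notation D := (generated cross_commutators).

(** With x, X, y, Y for a x, b x, a y, b y, the elements xy and XY commute;
    cancelling with xX = Xx and yY = Yy in xyXY = XYxy leaves
    X^-1 y X y^-1 = x^-1 Y x Y^-1, which is the claim for y^-1. *)
Lemma cross_swap g h : [~ a g, b h] = [~ b g, a h].
Proof.
have key x y :
    (b x)^-1 * a y * b x * (a y)^-1 = (a x)^-1 * b y * a x * (b y)^-1.
  have l : (a x * b x) * ((b x)^-1 * a y * b x * (a y)^-1) * (a y * b y)
      = a x * a y * (b x * b y) by rewrite !mulgA mulgK mulgVK.
  have r : (b x * a x) * ((a x)^-1 * b y * a x * (b y)^-1) * (b y * a y)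
      = b x * b y * (a x * a y) by rewrite !mulgA mulgK mulgVK.
  apply: (mulgI (a x * b x)); apply: (mulIg (a y * b y)); rewrite l.
  by rewrite (abC x) (abC y) r -aM -bM; exact: abC.
have := key g h^-1; rewrite (morph_inv aM) (morph_inv bM) !invgK => e.
by rewrite !commgEl !conjgE !mulgA e.
Qed.

Lemma cross_mull g k h : [~ a (g * k), b h] = [~ a g, b h] ^ a k * [~ a k, b h].
Proof.
by rewrite !commgEl aM !conjgE !invgM !mulgA !mulgK.
Qed.

Lemma cross_mulr g h k : [~ a g, b (h * k)] = [~ a g, b k] * [~ a g, b h] ^ b k.
Proof.
by rewrite !commgEl bM !conjgE !invgM !mulgA !mulgK.
Qed.

(** Expand both sides of [~ a (g * k), b h] = [~ b (g * k), a h] over the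
    product g * k. *)
Lemma cross_conj_ab g h k : [~ a g, b h] ^ b k = [~ a g, b h] ^ a k.
Proof.
have := cross_swap (g * k) h; rewrite cross_mull.
have -> : [~ b (g * k), a h] = [~ b g, a h] ^ b k * [~ b k, a h].
  by rewrite !commgEl bM !conjgE !invgM !mulgA !mulgK.
by rewrite -!cross_swap => /mulIg ->.
Qed.

Lemma cross_conj_a d k : D d -> D (d ^ a k).
Proof.
move: d; apply: generated_ind => [|x y|x|_ [g [h ->]]].
- by rewrite conj1g; exact: generated1.
- by rewrite conjMg; exact: generatedM.
- by rewrite conjVg; exact: generatedV.
suff -> : [~ a g, b h] ^ a k = [~ a (g * k), b h] * [~ a k, b h]^-1.
  apply: generatedM; last apply: generatedV; apply: sub_generated.
    by exists (g * k), h.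
  by exists k, h.
by rewrite cross_mull mulgK.
Qed.

Lemma generated_conj_ab d k : D d -> d ^ b k = d ^ a k.
Proof.
move: d; apply: generated_ind => [|x y|x|_ [g [h ->]]].
- by rewrite !conj1g.
- by rewrite !conjMg => -> ->.
- by rewrite !conjVg => ->.
exact: cross_conj_ab.
Qed.

Hypothesis TC : forall g h g' h', commute [~ a g, b h] [~ a g', b h'].

Lemma generated_cross_abelian x y : D x -> D y -> commute x y.
Proof.
move=> Dx; suff: D `<=` [set z | commute x z] by apply.
apply: generated_ind => /=; [exact: commute1|exact: commuteM|exact: commuteV|].
move=> _ [g [h ->]]; move: x Dx.
suff: D `<=` [set z | commute [~ a g, b h] z] by move=> sub x /sub/commute_sym.
apply: generated_ind => /=; [exact: commute1|exact: commuteM|exact: commuteV|].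
by move=> _ [g' [h' ->]]; exact: TC.
Qed.

(** Since a l and b l act alike on D, the image of [~ k, l] acts as
    [~ a k, b l], which lies in the abelian group D. *)
Lemma cross_conj_commutator d k l : D d -> d ^ a [~ k, l] = d.
Proof.
move=> Dd.
have DV x m : D x -> D (x ^ (a m)^-1) /\ x ^ (b m)^-1 = x ^ (a m)^-1.
  move=> Dx; rewrite -(morph_inv aM) -(morph_inv bM).
  split; first exact: cross_conj_a.
  exact: generated_conj_ab.
have -> : d ^ a [~ k, l] = d ^ [~ a k, b l].
  have commE (K : groupType) (x y : K) :
    [~ x, y] = x^-1 * (y^-1 * (x * y)) by [].
  rewrite !commE !aM !(morph_inv aM) !conjgM.
  rewrite (DV _ l _).2; last exact: (DV _ k _).1.
  rewrite generated_conj_ab //; apply: cross_conj_a.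
  by apply: (DV _ l _).1; exact: (DV _ k _).1.
apply/conjg_fixP/commgP; apply: generated_cross_abelian => //.
by apply: sub_generated; exists k, l.
Qed.

(** With c(g, h) = [~ a g, b h] and e = [~ h, g], the element u = c(g, e)
    measures the failure of g to fix t = c(g, h).  All powers u^m = c(g, e^m)
    lie in T, so u^n = 1 for some n > 0.  Then g fixes t^n, so that the powers
    of t^n are the n-th powers of the c(g^m, h), again finitely many. *)
Lemma cross_finite_order : finite_set T ->
  forall g h, finite_order [~ a g, b h].
Proof.
move=> finT g h; pose e := [~ h, g]; set t := [~ a g, b h].
have DT x y : D [~ a x, b y] by apply: sub_generated; exists x, y.
have conj_e d : D d -> d ^ b e = d.
  by move=> Dd; rewrite generated_conj_ab // cross_conj_commutator.
pose u := [~ a g, b e].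
have uX n : [~ a g, b (e ^+ n)] = u ^+ n.
  elim: n => [|n IH].
    have b1 : b 1 = 1 by apply: (mulgI (b 1)); rewrite -bM !mulg1.
    by rewrite b1 commg1.
  by rewrite expgSr cross_mulr IH conj_e -?IH // IH expgS.
have tg : t ^ a g = u * t.
  have bJ : b h ^ b g = b (h ^ g).
    by rewrite [b h ^ _]/conjg -(morph_inv bM) -!bM.
  have aJ : a g ^ b g = a g by apply/conjg_fixP/commgP.
  rewrite -cross_conj_ab /t conjRg aJ bJ.
  have -> : h ^ g = h * e by rewrite /e commgEl mulgA mulgV mul1g.
  by rewrite cross_mulr conj_e.
have [n n0 un] : finite_order u.
  by apply: (finite_order_powers finT) => n; rewrite -uX; exists g, (e ^+ n).
have sg : (t ^+ n) ^ a g = t ^+ n.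
  by rewrite conjXg tg expgMn ?un ?mul1g //; exact: TC.
apply: (finite_orderX n0).
have sX m : [~ a (g ^+ m), b h] ^+ n = (t ^+ n) ^+ m.
  elim: m => [|m IH].
    have a1 : a 1 = 1 by apply: (mulgI (a 1)); rewrite -aM !mulg1.
    by rewrite a1 comm1g expg1n.
  rewrite expgSr cross_mull expgMn; last first.
    by apply: generated_cross_abelian => //; exact: cross_conj_a.
  rewrite -conjXg IH -/t [RHS]expgSr; congr (_ * _).
  by rewrite conjXg sg.
apply: (finite_order_powers (finite_image (fun x => x ^+ n) finT)) => m.
by rewrite -sX; eexists; first by exists (g ^+ m), h.
Qed.

End WeaklyCommuting.

(** * The weak commutativity group *)

Lemma quot_pi_morph (H : groupType) (S : set H) :
  {morph (@quot_pi H S : H -> quot_ncl S) : x y / x * y}.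
Proof. by move=> x y; exact/esym/quot_piM. Qed.

Lemma quot_pi_commute (H : groupType) (S : set H) (x y : H) :
  S [~ x, y] -> commute (quot_pi S x) (quot_pi S y).
Proof.
move=> Sxy; rewrite /commute -!quot_pi_morph; apply/esym/quot_piP.
rewrite invgM -mulgA -/(conjg x y) -commgEl.
by move=> A [_]; apply.
Qed.

Lemma quot_pi_commg (H : groupType) (S : set H) (x y : H) :
  [~ quot_pi S x, quot_pi S y] = quot_pi S [~ x, y].
Proof.
have V := morph_inv (@quot_pi_morph H S).
by rewrite !commgEl /conjg !quot_pi_morph !V.
Qed.

Section WeakCommutativityGroup.
Variable G : groupType.

Lemma chi_inlM : {morph @chi_inl G : x y / x * y}.
Proof.
move=> x y; rewrite /chi_inl -[RHS]quot_pi_morph; congr quot_pi.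
by rewrite [RHS]free_piM; apply/esym/free_piP/word_mul_l.
Qed.

Lemma chi_inrM : {morph @chi_inr G : x y / x * y}.
Proof.
move=> x y; rewrite /chi_inr -[RHS]quot_pi_morph; congr quot_pi.
by rewrite [RHS]free_piM; apply/esym/free_piP/word_mul_r.
Qed.

Lemma chi_commute g : commute (@chi_inl G g) (chi_inr g).
Proof. by apply: quot_pi_commute; exists g. Qed.

(** On D the second factor acts as the first one, so in a word for w every
    letter can be taken in the first factor. *)
Lemma D_chi_conj_inl (w : chi G) :
  exists k, forall d, D_chi G d -> d ^ w = d ^ chi_inl k.
Proof.
rewrite -(quot_reprK w) -(free_reprK (repr w)).
elim: (repr (repr w)) => [|c u [k IH]].
  exists 1 => d _; have -> : chi_inl 1 = 1 :> chi G.
    by apply: (mulgI (chi_inl 1)); rewrite -chi_inlM !mulg1.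
  by rewrite [quot_pi _ _](_ : _ = 1).
rewrite -cat1s -free_piM [quot_pi _ _]quot_pi_morph.
suff [l Dl] : exists l, forall d, D_chi G d ->
    d ^ quot_pi (chi_relators G) (free_pi [:: c]) = d ^ chi_inl l.
  exists (l * k) => d Dd; rewrite chi_inlM !conjgM Dl // IH //.
  exact: (cross_conj_a chi_inlM).
case: c => l; exists l => d Dd //.
exact: (generated_conj_ab chi_inlM chi_inrM chi_commute).
Qed.

(** Every conjugate of [g, h^phi] is a conjugate by some k in G, and this is
    [gk, h^phi] [k, h^phi]^-1. *)
Lemma T_chi_conj_finite : finite_set (T_chi G) ->
  finite_set [set x | exists d w, T_chi G d /\ x = d ^ w].
Proof.
move=> finT; have := finite_image2 (fun x y : chi G => x * y^-1) finT finT.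
apply: sub_finite_set => _ [_ [w [[g [h ->]] ->]]].
have [k ->] := D_chi_conj_inl w; last by apply: sub_generated; exists g, h.
exists [~ chi_inl (g * k), chi_inr h]; first by eexists; eexists.
exists [~ chi_inl k, chi_inr h]; first by eexists; eexists.
by rewrite (cross_mull _ chi_inlM) mulgK.
Qed.

End WeakCommutativityGroup.

Theorem theoremB (G : groupType) :
  finite_set (T_chi G) <-> finite_set (D_chi G).
Proof.
split=> [finT|]; last by apply: sub_finite_set; exact: sub_generated.
pose X := [set x | exists d w, T_chi G d /\ x = d ^ w].
have XJ x w : X x -> X (x ^ w).
  by move=> [d [v [Td ->]]]; exists d, (v * w); rewrite conjgM.
have TX : T_chi G `<=` X by move=> d Td; exists d, 1; rewrite conjg1.
have finX : finite_set X := T_chi_conj_finite finT.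
pose S := mixed_commutators X; pose p : chi G -> quot_ncl S := quot_pi S.
(* The elements of T commute modulo the normal closure of S, so the abelian
   case applies to their images. *)
have p_order g h : finite_order [~ p (chi_inl g), p (chi_inr h)].
  apply: (@cross_finite_order _ _ (p \o @chi_inl G) (p \o @chi_inr G)).
  - by move=> x y; rewrite /= chi_inlM; exact: quot_pi_morph.
  - by move=> x y; rewrite /= chi_inrM; exact: quot_pi_morph.
  - move=> x; apply: (morph_commute (@quot_pi_morph _ S)).
    exact: chi_commute.
  - move=> x y x' y'; rewrite !(@quot_pi_commg _ S); apply: quot_pi_commute.
    exists [~ chi_inl x, chi_inr y], [~ chi_inl x', chi_inr y']; split=> //.
      by apply: TX; exists x, y.
    by apply: sub_generated; apply: TX; exists x', y'.
  have := finite_image p finT; apply: sub_finite_set => _ [x [y ->]].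
  exists [~ chi_inl x, chi_inr y]; first by exists x, y.
  by rewrite (@quot_pi_commg _ S).
have finS : finite_set (generated S).
  exact: generated_mixed_commutators_finite.
suff finDX : finite_set (generated X).
  apply: sub_finite_set finDX; apply: generated_ind => [|||d /TX].
  - exact: generated1.
  - exact: generatedM.
  - exact: generatedV.
  - exact: sub_generated.
apply: generated_finite_of_finite_order => // [x y Xx _|]; first exact: XJ.
move=> _ [_ [w [[g [h ->]] ->]]]; apply: finite_orderJ.
have [n n0] := p_order g h; set t := [~ chi_inl g, chi_inr h].
have pX m : p t ^+ m = p (t ^+ m).
  by elim: m => [//|m IH]; rewrite !expgS IH [RHS]quot_pi_morph.
rewrite (@quot_pi_commg _ S) pX => e; apply: (finite_orderX n0).
have tS : generated S (t ^+ n).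
  apply: normal_closure_sub_generated; first exact: mixed_commutatorsJ.
  by rewrite -[t ^+ n]mul1g -[1]invg1; apply/quot_piP/esym.
apply: (finite_order_powers finS); elim => [|m IH]; first exact: generated1.
by rewrite expgS; exact: generatedM.
Qed.
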